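(* Let $r,q,n$ be positive integers with $q\mid r$ and $\gcd(q,n)\le2$, and let $G=G(r,q,n)$. Then $s(G)\ge\Gamma_e(G)$, and $s(G)=\Gamma_e(G)$ if and only if $G$ is abelian.
   Context: $G(r,1,n)=\{(z_1,\dots,z_n;\sigma):z_i\in\mathbb{Z}_r,\sigma\in S_n\}$ with product $(z;\sigma)(z';\sigma')=(z_1+z'_{\sigma^{-1}(1)},\dots,z_n+z'_{\sigma^{-1}(n)};\sigma\sigma')$, and for $q\mid r$, $G(r,q,n)=\{(z_1,\dots,z_n;\sigma)\in G(r,1,n):\sum_i z_i\equiv0\pmod q\}$. For a finite group $G$, $s(G)$ is the sum of all entries of its complex character table and $\Gamma_e(G)$ is the sum of the degrees of its irreducible complex characters. *)

(* Defs.v *)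
From mathcomp Require Import all_boot all_order all_algebra all_fingroup all_solvable all_field all_character.
Set Implicit Arguments. Unset Strict Implicit. Unset Printing Implicit Defensive.
Import GRing.Theory Num.Theory.
Local Open Scope ring_scope.

(* G(r,q,n) realized as a permutation group on Z_r x {0..n-1}:
   (z;sigma) acts by (a,i) |-> (a + z_{sigma i} mod r, sigma i).
   This is a faithful (anti-)representation; the image set is closed under
   product and inverse, hence a subgroup isomorphic to G(r,q,n). *)
Definition Grqn_set (r q n : nat) : {set {perm 'I_r * 'I_n}} :=
  [set p : {perm 'I_r * 'I_n} |
     [exists z : {ffun 'I_n -> 'I_r}, exists s : {perm 'I_n},
        ((\sum_(i < n) (z i : nat)) %% q == 0)%N &&
        [forall x : 'I_r * 'I_n,
           (((p x).1 : nat) == (x.1 + z (s x.2)) %% r)%N && ((p x).2 == s x.2)]]].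

(* The group G(r,q,n): the subgroup generated by (in fact equal to) Grqn_set. *)
Definition Grqn (r q n : nat) : {group {perm 'I_r * 'I_n}} := <<Grqn_set r q n>>%G.

Definition char_table_sum (gT : finGroupType) (G : {group gT}) : algC :=
  \sum_(i < Nirr G) \sum_(j < Nirr G) character_table G i j.

Definition Gamma_e (gT : finGroupType) (G : {group gT}) : algC :=
  \sum_(i < Nirr G) 'chi[G]_i 1%g.

(* Main.v *)
Require Import Defs.
From mathcomp Require Import all_boot all_order all_algebra all_fingroup all_solvable all_field all_character.
Import GRing.Theory Num.Theory.
Local Open Scope ring_scope.
Set Implicit Arguments. Unset Strict Implicit. Unset Printing Implicit Defensive.

(** View G(r,q,n) as a group of monomial matrices and let [sigma] be
    transposition, an anti-automorphism. If every irreducible representation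
    [rho] satisfies [rho (sigma x) = rho(x)^T] in a suitable basis, its
    Frobenius-Schur indicator twisted by complex conjugation is 1, and then the
    sum of the column of [g] in the character table is a positive multiple of
    the number of [x] for which [x * conj x] is conjugate to [g]. So the column
    sums are nonnegative, and all but that of the identity vanish only if
    [conj x = x^-1] for every [x], which forces the group to be abelian.

    The invariant form exchanging [rho x] and [rho (sigma x)] is symmetric by
    descent along the subgroups fixing more and more of the indices, down to
    the diagonal subgroup. If every element of [G] is [H]-conjugate to its
    transpose, each endomorphism commuting with [H] is self-adjoint, as an
    [H]-average of group elements; hence an [H]-equivariant projection onto a
    simple [H]-module is orthogonal, and the form restricts to a nonzero form
    there. The conjugating elements invert the abelian group generated by [g]
    and the scalar rotation; their colour is corrected modulo [q] by scalars,
    up to a parity obstruction when [gcd(q,n) = 2], which disappears by a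
    2-colouring of the cycles of [g]. *)

(** * Anti-automorphisms and invariant forms *)

Definition antimorphic {gT : finGroupType} (sigma : gT -> gT) :=
  {morph sigma : x y / (x * y)%g >-> (y * x)%g}.

(** With [B] read as the form [u *m B *m v^T] on row vectors, the condition makes [rG x] and
    [rG (sigma x)] adjoint to each other. *)
Definition symmetric_intertwiners {gT : finGroupType} (sigma : gT -> gT)
    (G : {group gT}) : Prop :=
  forall n (rG : mx_representation algC G n), mx_irreducible rG ->
  forall B : 'M_n,
    (forall x, x \in G -> rG x *m B = B *m (rG (sigma x))^T) -> B^T = B.

Lemma anti1 (gT : finGroupType) (sigma : gT -> gT) :
  antimorphic sigma -> sigma 1%g = 1%g.
Proof. by move=> sM; apply: (mulgI (sigma 1%g)); rewrite -sM !mulg1. Qed.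

Lemma antiV (gT : finGroupType) (sigma : gT -> gT) (x : gT) :
  antimorphic sigma -> sigma x^-1%g = (sigma x)^-1%g.
Proof.
move=> sM; apply: (mulgI (sigma x)); rewrite -sM mulVg mulgV; exact: anti1.
Qed.

Lemma antiJ (gT : finGroupType) (sigma : gT -> gT) (x y : gT) :
  antimorphic sigma -> sigma (x ^ y)%g = (sigma x ^ (sigma y)^-1)%g.
Proof. by move=> sM; rewrite !conjgE invgK !sM (antiV _ sM) mulgA. Qed.

(** * Symmetry of invariant forms by descent to a subgroup *)

Lemma abelian_symmetric_intertwiners (gT : finGroupType) (sigma : gT -> gT)
    (G : {group gT}) :
  abelian G -> symmetric_intertwiners sigma G.
Proof.
move=> abG n rG irrG B _.
have n1 := mx_irr_abelian_linear (@groupC _ G) irrG abG.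
rewrite {}n1 in B *; by apply/matrixP=> i j; rewrite !mxE !ord1.
Qed.

Lemma intertwiner_row_free (gT : finGroupType) (sigma : gT -> gT)
    (G : {group gT}) n (rG : mx_representation algC G n) (D : 'M_n) :
    mx_irreducible rG ->
    (forall x, x \in G -> rG x *m D = D *m (rG (sigma x))^T) ->
  D != 0 -> row_free D.
Proof.
move=> /mx_irrP[_ irrG] twD nzD.
rewrite -kermx_eq0; apply: contraR nzD => nzK.
have modK : mxmodule rG (kermx D).
  apply/mxmoduleP=> x Gx; apply/sub_kermxP.
  by rewrite -mulmxA twD // mulmxA mulmx_ker mul0mx.
have := irrG _ modK nzK; rewrite -sub1mx => /sub_kermxP.
by rewrite mul1mx => ->.
Qed.

(** For [H] inside [G], this is [#|H|] times the projection of [M] onto the commutant of [H]. *)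
Definition conj_sum {gT : finGroupType} {G : {group gT}} {n}
    (rG : mx_representation algC G n) (H : {group gT}) (M : 'M_n) : 'M_n :=
  \sum_(h in H) rG h^-1%g *m M *m rG h.

Lemma conj_sum_commuting (gT : finGroupType) (G H : {group gT}) n
    (rG : mx_representation algC G n) (M : 'M_n) :
    H \subset G -> (forall h, h \in H -> M *m rG h = rG h *m M) ->
  conj_sum rG H M = #|H|%:R *: M.
Proof.
move=> sHG cM; rewrite /conj_sum scaler_nat -sumr_const.
apply: eq_bigr => h Hh; rewrite -mulmxA cM // mulmxA.
rewrite -repr_mxM ?groupV ?(subsetP sHG) //.
by rewrite mulVg repr_mx1 mul1mx.
Qed.

(* Reversal by [sigma] permutes the [H]-conjugates of [g], so each
   [H]-averaged group element is self-adjoint for the form [D]. *)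
Lemma conj_sum_adjoint (gT : finGroupType) (sigma : gT -> gT)
    (G H : {group gT}) n (rG : mx_representation algC G n) (D M : 'M_n) :
    antimorphic sigma -> injective sigma -> H \subset G ->
    {in H, forall h, sigma h \in H} ->
    {in G, forall g, exists2 k, k \in H & sigma g = (g ^ k)%g} ->
    mx_irreducible rG ->
    (forall x, x \in G -> rG x *m D = D *m (rG (sigma x))^T) ->
  conj_sum rG H M *m D = D *m (conj_sum rG H M)^T.
Proof.
move=> sM sI sHG sH sJ irrG twD.
(* By Burnside's theorem the matrices [rG x] span all matrices, so linearity reduces the claim to
   [M = rG x]. *)
have /mx_abs_irrP[_ [a aE]] : mx_absolutely_irreducible rG by apply: groupC.
pose b x := a x M; have -> : M = \sum_(x in G) b x *: rG x by apply: aE.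
have conj_sum_lin : conj_sum rG H (\sum_(x in G) b x *: rG x)
    = \sum_(x in G) b x *: \sum_(h in H) rG (x ^ h)%g.
  rewrite /conj_sum; under eq_bigr do rewrite mulmx_sumr mulmx_suml.
  rewrite exchange_big /=; apply: eq_bigr => x Gx; rewrite scaler_sumr.
  apply: eq_bigr => h Hh; have Gh := subsetP sHG h Hh.
  by rewrite -scalemxAr -scalemxAl conjgE mulgA !repr_mxM ?groupM ?groupV.
rewrite {}conj_sum_lin !linear_sum mulmx_suml; apply: eq_bigr => x Gx.
rewrite !linearZ /= -scalemxAl; congr (_ *: _).
transitivity (\sum_(h in H) D *m (rG (sigma (x ^ h)%g))^T).
  rewrite mulmx_suml; apply: eq_bigr => h Hh.
  by rewrite twD // groupJ // (subsetP sHG).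
rewrite -mulmx_sumr; congr (_ *m _); rewrite linear_sum /=.
have [k Hk sx] := sJ x Gx.
(* [sigma (x ^ h) = x ^ f h], and [f] permutes [H]. *)
pose f h := (k * (sigma h)^-1)%g.
have fI : injective f by move=> h1 h2 /mulgI/invg_inj/sI.
have fH h : h \in H -> f h \in H by move=> Hh; rewrite groupM ?groupV ?sH.
have fHE : f @: H = H.
  apply/eqP; rewrite eqEcard card_imset // leqnn andbT.
  by apply/subsetP=> _ /imsetP[h Hh ->]; apply: fH.
rewrite -[in RHS]fHE big_imset /=; last by move=> ? ? _ _; apply: fI.
by apply: eq_bigr => h Hh; rewrite (antiJ _ _ sM) sx -conjgM.
Qed.

(** The skew part [D] of an invariant form is invariant. If nonzero it is nondegenerate and
    restricts to a nonzero skew form on a simple [H]-module, where invariant forms are symmetric. *)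
Lemma subgroup_symmetric_intertwiners (gT : finGroupType) (sigma : gT -> gT)
    (G H : {group gT}) :
    antimorphic sigma -> involutive sigma -> H \subset G ->
    {in G, forall g, sigma g \in G} -> {in H, forall h, sigma h \in H} ->
    {in G, forall g, exists2 k, k \in H & sigma g = (g ^ k)%g} ->
  symmetric_intertwiners sigma H -> symmetric_intertwiners sigma G.
Proof.
move=> sM sK sHG sG sH sJ symH n rG irrG B twB.
pose D := B - B^T.
have DT : D^T = - D by rewrite linearB /= trmxK opprB.
have twD x : x \in G -> rG x *m D = D *m (rG (sigma x))^T.
  move=> Gx; rewrite mulmxBr mulmxBl twB //; congr (_ - _).
  by rewrite -!trmx_mul twB ?sG // sK trmx_mul trmxK.
apply/eqP; rewrite eq_sym -subr_eq0 -/D; apply/idPn => nzD.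
have freeD := intertwiner_row_free irrG twD nzD.
have self_adj M : (forall h, h \in H -> M *m rG h = rG h *m M) -> M *m D = D *m M^T.
  move=> cM; have := conj_sum_adjoint M sM (can_inj sK) sHG sH sJ irrG twD.
  rewrite conj_sum_commuting // linearZ /= -scalemxAl -scalemxAr.
  by apply: scalerI; rewrite pnatr_eq0 -lt0n cardG_gt0.
pose rH := subg_repr rG sHG.
have [n_gt0 _] := (mx_irrP _).1 irrG.
have nz1 : (1%:M : 'M[algC]_n) != 0 by rewrite -mxrank_eq0 mxrank1 -lt0n.
have [U simU _] := dec_mxsimple_exists (mxmodule1 rH) nz1.
have [modU nzU _] := simU.
have [W modW defUW dxUW] := mx_Maschke_pchar rH (algC'G_pchar H) modU (submx1 U).
pose e := proj_mx U W.
have {}dxUW := mxdirect_addsP dxUW.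
have ce h : h \in H -> e *m rG h = rG h *m e.
  move=> Hh; have := proj_mx_hom dxUW modU modW.
  by rewrite defUW => /hom_mxP/(_ h Hh); rewrite !mul1mx.
have ee : e *m e = e by apply: proj_mx_proj.
(* The self-adjoint idempotent [e] is an orthogonal projection onto [U], so [e *m D] is determined
   by [D] on [U]. *)
have eDe : e *m D *m e^T = e *m D by rewrite -mulmxA -self_adj // mulmxA ee.
(* The rows of [P] are a basis of [U], so [C] below is the Gram matrix of [D] on [U]. *)
pose P := val_submod (1%:M : 'M_(\rank U)).
have PJ h : h \in H -> P *m rG h = submod_repr modU h *m P.
  move=> Hh; rewrite -[rG h]/(rH h) -(val_submodJ modU) // mul1mx.
  by rewrite [LHS]val_submodE.
have [Q eQ] : exists Q, e = Q *m P.
  apply/submxP; rewrite val_submod1; by rewrite -[e]mul1mx proj_mx_sub.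
clearbody P; pose C := P *m D *m P^T.
have C0 : C = 0.
  have CT : C^T = C.
    apply: (symH _ (submod_repr modU)); first exact/submod_mx_irr.
    move=> h Hh; rewrite /C !mulmxA -PJ // -[P *m _ *m D]mulmxA twD ?(subsetP sHG) //.
    by rewrite -!mulmxA -!trmx_mul -PJ ?sH.
  have : C^T = - C by rewrite !trmx_mul trmxK DT mulNmx mulmxN mulmxA.
  rewrite CT => /eqP; rewrite -addr_eq0 -mulr2n -scaler_nat scaler_eq0 pnatr_eq0.
  by move/eqP.
have eD0 : e *m D = 0.
  by rewrite -eDe eQ trmx_mul !mulmxA -(mulmxA Q) -(mulmxA Q) -/C C0 mulmx0 mul0mx.
have e0 : e = 0 by apply/(row_free_inj freeD); rewrite eD0 mul0mx.
have := proj_mx_id dxUW (submx_refl U); rewrite -/e e0 mulmx0 => U0.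
by rewrite -U0 eqxx in nzU.
Qed.

(** * Orthogonality of matrix entries and the twisted indicator *)

Lemma conj_sum_irr (gT : finGroupType) (G : {group gT}) n
    (rG : mx_representation algC G n) (M : 'M_n) :
  mx_irreducible rG -> conj_sum rG G M = (#|G|%:R / n%:R * \tr M)%:M.
Proof.
move=> irrG; have [n_gt0 _] := (mx_irrP _).1 irrG.
have nz_n : n%:R != 0 :> algC by rewrite pnatr_eq0 -lt0n.
have absG : mx_absolutely_irreducible rG by apply: groupC.
have cM : centgmx rG (conj_sum rG G M).
  apply/centgmxP=> x Gx; rewrite /conj_sum mulmx_suml mulmx_sumr.
  rewrite (reindex_inj (mulIg x^-1%g)) /=.
  rewrite (eq_bigl (mem G)) => [|h]; last by rewrite groupMr ?groupV.
  apply: eq_bigr => h Gh; rewrite invMg invgK !repr_mxM ?groupV //.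
  by rewrite -!mulmxA -repr_mxM ?groupV // mulVg repr_mx1 mulmx1.
(* By Schur's lemma the average is scalar; its trace determines the scalar. *)
have /is_scalar_mxP[a aE] := mx_abs_irr_cent_scalar absG cM.
rewrite aE; congr (_%:M).
have : \tr (conj_sum rG G M) = #|G|%:R * \tr M.
  rewrite /conj_sum linear_sum /= mulr_natl -sumr_const.
  apply: eq_bigr => h Gh; rewrite mxtrace_mulC mulmxA -repr_mxM ?groupV //.
  by rewrite mulgV repr_mx1 mul1mx.
rewrite aE mxtrace_scalar => trE.
by rewrite mulrAC -trE -[a *+ n]mulr_natr mulfK.
Qed.

(** The sum is entry [(l, j)] of the averaged matrix unit [delta_mx k i]. *)
Lemma repr_entry_orthogonality (gT : finGroupType) (G : {group gT}) n
    (rG : mx_representation algC G n) (i j k l : 'I_n) :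
    mx_irreducible rG ->
  \sum_(x in G) rG x i j * rG x^-1%g l k
    = #|G|%:R / n%:R * ((i == k) && (j == l))%:R.
Proof.
move=> irrG; have /matrixP/(_ l j) := conj_sum_irr (delta_mx k i) irrG.
rewrite mxE summxE.
have -> : \tr (delta_mx k i : 'M[algC]_n) = (i == k)%:R.
  rewrite /mxtrace (bigD1 i) //= mxE eqxx andbT big1 ?addr0 // => m /negPf ne.
  by rewrite mxE ne andbF.
rewrite -mulrnAr -mulrnA mulnb [l == j]eq_sym => <-.
apply: eq_bigr => x _; rewrite !mxE (bigD1 i) //= big1 => [|m ne]; last first.
  rewrite mxE big1 ?mul0r // => p _.
  by rewrite mxE (negPf ne) andbF mulr0.
rewrite mxE (bigD1 k) //= big1 => [|m ne]; last by rewrite mxE (negPf ne) mulr0.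
by rewrite mxE !eqxx mulr1 !addr0 mulrC.
Qed.

Lemma mxtrace_mul4 n (A B C D : 'M[algC]_n) :
  \tr (A *m B *m C *m D)
    = \sum_i \sum_l \sum_k \sum_j A i j * B j k * C k l * D l i.
Proof.
apply: eq_bigr => i _; rewrite mxE; apply: eq_bigr => l _.
rewrite mxE mulr_suml; apply: eq_bigr => k _.
by rewrite mxE !mulr_suml.
Qed.

(** This is the dual representation composed with [x |-> sigma x^-1]. *)
Lemma anti_dual_repr_proof (gT : finGroupType) (sigma : gT -> gT)
    (G : {group gT}) n (rG : mx_representation algC G n) :
    antimorphic sigma -> {in G, forall g, sigma g \in G} ->
  mx_repr G (fun x => (rG (sigma x))^T).
Proof.
move=> sM sG; split; first by rewrite (anti1 sM) repr_mx1 trmx1.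
by move=> x y Gx Gy; rewrite sM repr_mxM ?sG // trmx_mul.
Qed.

(* The Frobenius-Schur indicator of [chi_i] twisted by the automorphism
   [x |-> sigma x^-1] is 1. *)
Lemma twisted_indicator (gT : finGroupType) (sigma : gT -> gT)
    (G : {group gT}) (i : Iirr G) :
    antimorphic sigma -> {in G, forall g, sigma g \in G} ->
    {in G, forall g, exists2 k, k \in G & sigma g = (g ^ k)%g} ->
    symmetric_intertwiners sigma G ->
  \sum_(x in G) 'chi_i (x * sigma x^-1)%g = #|G|%:R.
Proof.
move=> sM sG sJ symG.
have /irr_reprP[[n rG] /= irrG ->] := mem_irr i.
have [n_gt0 _] := (mx_irrP _).1 irrG.
have nz_n : n%:R != 0 :> algC by rewrite pnatr_eq0 -lt0n.
pose rD := MxRepresentation (anti_dual_repr_proof rG sM sG).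
(* As [sigma x] is conjugate to [x], the twisted dual has the same character, hence is isomorphic to
   [rG] through some [B]. *)
have /cfRepr_rsimP[B _ freeB twB] : cfRepr rG == cfRepr rD.
  apply/eqP/cfun_inP=> x Gx; rewrite !cfunE Gx /= mxtrace_tr.
  have [k Gk ->] := sJ x Gx; rewrite conjgE !repr_mxM ?groupM ?groupV //.
  by rewrite mxtrace_mulC -mulmxA -repr_mxM ?groupV // mulgV repr_mx1 mulmx1.
have unitB : B \in unitmx by rewrite -row_free_unit.
have symB := symG _ _ irrG _ twB.
have rGs x : x \in G -> rG (sigma x) = B *m (rG x)^T *m invmx B.
  move=> Gx; apply: (canRL (mulmxK unitB)); apply: trmx_inj.
  by rewrite !trmx_mul trmxK symB twB.
transitivity (\sum_(x in G) \tr (rG x *m B *m (rG x^-1%g)^T *m invmx B)).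
  apply: eq_bigr => x Gx; rewrite cfunE groupM ?sG ?groupV // mulr1n.
  by rewrite repr_mxM ?sG ?groupV // rGs ?groupV // !mulmxA.
under eq_bigr do rewrite mxtrace_mul4.
transitivity (\sum_a \sum_d \sum_c \sum_b
    (B b c * invmx B d a) * (#|G|%:R / n%:R * ((a == c) && (b == d))%:R) : algC).
  do 4![rewrite exchange_big; apply: eq_bigr => ? _].
  rewrite -(repr_entry_orthogonality _ _ _ _ irrG) mulr_sumr.
  by apply: eq_bigr => x Gx; rewrite mxE -mulrA mulrACA mulrC.
transitivity (#|G|%:R / n%:R * \tr (B *m invmx B)); last first.
  by rewrite mulmxV // mxtrace1 divfK.
(* Only [c = a], [b = d] survive. Symmetry of [B] makes the remaining sum the trace of
   [B *m invmx B]; a skew [B] would give the opposite sign. *)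
rewrite -[in RHS]symB /mxtrace mulr_sumr; apply: eq_bigr => a _.
rewrite mxE mulr_sumr; apply: eq_bigr => d _.
rewrite (bigD1 a) //= [X in _ + X]big1 => [|c ne]; last first.
  by rewrite big1 // => b _; rewrite [a == c]eq_sym (negPf ne) !mulr0.
rewrite (bigD1 d) //= [X in _ + X + _]big1 => [|b ne]; last first.
  by rewrite (negPf ne) andbF !mulr0.
by rewrite !eqxx mulr1 !addr0 mxE symB mulrC.
Qed.

(** * Column sums of the character table *)

Lemma sum_irr_twisted_squares (gT : finGroupType) (sigma : gT -> gT)
    (G : {group gT}) (g : gT) :
    antimorphic sigma -> {in G, forall g, sigma g \in G} ->
    {in G, forall g, exists2 k, k \in G & sigma g = (g ^ k)%g} ->
    symmetric_intertwiners sigma G ->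
  \sum_i 'chi[G]_i g
    = #|'C_G[g]%g|%:R / #|G|%:R
      * #|[set x in G | g \in (x * sigma x^-1) ^: G]%g|%:R.
Proof.
move=> sM sG sJ symG.
have nzG : #|G|%:R != 0 :> algC by rewrite pnatr_eq0 -lt0n cardG_gt0.
apply: (mulIf nzG); rewrite mulrAC divfK // mulr_suml.
(* The factor [#|G|] is replaced by the twisted indicator sum of each ['chi_i]; column orthogonality
   then counts the [x] with [x * sigma x^-1] conjugate to [g]. *)
transitivity (\sum_(x in G) \sum_i 'chi[G]_i g * ('chi_i (x * sigma x^-1)%g)^*).
  rewrite exchange_big /=; apply: eq_bigr => i _.
  rewrite -mulr_sumr -rmorph_sum /=.
  by rewrite (twisted_indicator _ sM sG sJ symG) conjC_nat.
under eq_bigr => x Gx.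
  rewrite second_orthogonality_relation ?groupM ?sG ?groupV // mulrb.
  over.
rewrite -big_mkcondr sumr_const mulr_natr; congr (_ *+ _).
by apply: eq_card => x; rewrite inE.
Qed.

(** All characters are linear, so the sum is the product of the column of [g] with that of 1. *)
Lemma sum_irr_abelian (gT : finGroupType) (G : {group gT}) (g : gT) :
  abelian G -> g != 1%g -> \sum_i 'chi[G]_i g = 0.
Proof.
move=> abG ne1; have := second_orthogonality_relation g (group1 G).
rewrite class1G inE (negPf ne1) mulr0n => sum0.
rewrite -[RHS]sum0; apply: eq_bigr => i _.
by rewrite lin_char1 ?rmorph1 ?mulr1 //; apply/char_abelianP.
Qed.

Lemma char_table_sum_classes (gT : finGroupType) (G : {group gT}) :
  char_table_sum G = Gamma_e G +
    \sum_(xG in classes G | xG != [set 1%g]) \sum_i 'chi[G]_i (repr xG).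
Proof.
rewrite /char_table_sum exchange_big /=.
have -> : \sum_j \sum_i character_table G i j
    = \sum_(xG in classes G) \sum_i 'chi[G]_i (repr xG).
  rewrite reindex_irr_class; apply: eq_bigr => j _.
  by apply: eq_bigr => i _; rewrite mxE.
rewrite (bigD1 [set 1%g]) ?classes1 //=.
by rewrite repr_set1.
Qed.

Lemma char_table_sum_twisted (gT : finGroupType) (sigma : gT -> gT)
    (G : {group gT}) :
    antimorphic sigma -> {in G, forall g, sigma g \in G} ->
    {in G, forall g, exists2 k, k \in G & sigma g = (g ^ k)%g} ->
    symmetric_intertwiners sigma G ->
  Gamma_e G <= char_table_sum G /\
  (char_table_sum G = Gamma_e G <-> abelian G).
Proof.
move=> sM sG sJ symG; rewrite char_table_sum_classes.
have ge0 g : 0 <= \sum_i 'chi[G]_i g.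
  by rewrite (sum_irr_twisted_squares _ sM sG sJ symG) mulr_ge0 ?divr_ge0 ?ler0n.
split; first by rewrite lerDl sumr_ge0.
split=> [/eqP | abG].
  rewrite -subr_eq0 addrAC subrr add0r psumr_eq0 // => /allP sum0.
  suff sigma_id x : x \in G -> sigma x = x.
    apply/centsP=> x Gx y Gy; rewrite /commute.
    by rewrite -[LHS]sigma_id ?groupM // sM !sigma_id.
  (* If [g] were not 1, the column sum at its class would be positive, [x^-1] being among the
     elements counted. *)
  move=> Gx; apply/eqP; rewrite eq_sym eq_mulVg1; set g := (x^-1 * sigma x)%g.
  have Gg : g \in G by rewrite groupM ?groupV ?sG.
  apply/idPn=> ne1; have := sum0 (g ^: G)%g (mem_index_enum _).
  rewrite mem_classes //= implybE => /orP[|].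
    rewrite negbK => /eqP/setP/(_ g); rewrite class_refl inE => /esym.
    by rewrite (negPf ne1).
  rewrite (sum_irr_twisted_squares _ sM sG sJ symG); apply/negP.
  rewrite !mulf_neq0 ?invr_eq0 ?pnatr_eq0 -?lt0n ?cardG_gt0 //.
  apply/card_gt0P; exists x^-1%g; rewrite inE groupV Gx invgK.
  by have [y Gy ->] := repr_class G g; rewrite memJ_class.
rewrite big1 ?addr0 // => xG /andP[GxG ne1]; apply: sum_irr_abelian => //.
apply: contra ne1 => /eqP r1; have [_] := repr_classesP GxG.
by rewrite r1 class1G => ->.
Qed.

(** * Inverting an abelian permutation group; 2-colourings of cycles *)

Lemma abelian_inverter (T : finType) (L : {group {perm T}}) (x0 : T) :
    abelian L ->
  exists u : {perm T}, [/\ u x0 = x0,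
    forall (l : {perm T}) x, l \in L -> u (l x) = (l^-1)%g (u x)
    & forall x, exists2 l : {perm T}, l \in L & u x = l (l x)].
Proof.
move=> abL; have cL l m : l \in L -> m \in L -> (l * m = m * l)%g.
  by move=> Ll Lm; apply: (centsP abL).
pose orb := orbit 'P L.
(* Each orbit contains [x], so the default is never taken and [rep] depends only on the orbit. *)
pose rep x := if x0 \in orb x then x0 else odflt x [pick y in orb x].
have rep_orb x : rep x \in orb x.
  rewrite /rep; case: ifP => // _.
  by case: pickP => [//|/(_ x)]; rewrite orbit_refl.
have rep_act l x : l \in L -> rep (l x) = rep x.
  move=> Ll; have eqo : orb (l x) = orb x := orbit_act 'P x Ll.
  rewrite /rep eqo; case: ifP => // _.
  by case: pickP => [//|/(_ x)]; rewrite orbit_refl.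
have lamP x : exists l : {perm T}, (l \in L) && (l (rep x) == x).
  have := rep_orb x; rewrite /orb orbit_sym => /orbitP[l Ll lx].
  by exists l; rewrite Ll; apply/eqP.
pose lam x := xchoose (lamP x).
have Llam x : lam x \in L by case/andP: (xchooseP (lamP x)).
have lamE x : lam x (rep x) = x by case/andP: (xchooseP (lamP x)) => _ /eqP.
(* The map sends [l (rep x)] to [l^-1 (rep x)]; as [L] is abelian, the choice of [l] does not
   matter. *)
pose f x := ((lam x)^-1)%g (rep x).
have fE l x : l \in L -> l (rep x) = x -> f x = (l^-1)%g (rep x).
  move=> Ll lx; rewrite /f; set m := lam x.
  have [Lm mx] : m \in L /\ m (rep x) = x by split; [apply: Llam|apply: lamE].
  have : (l * (m^-1 * l^-1))%g (rep x) = (m * (m^-1 * l^-1))%g (rep x).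
    by rewrite permM lx [in RHS]permM mx.
  by rewrite mulKVg mulgA (cL l m^-1%g) ?groupV // mulgK.
have f_act l x : l \in L -> f (l x) = (l^-1)%g (f x).
  move=> Ll; rewrite (fE (lam x * l)%g) ?groupM ?rep_act //.
    by rewrite (cL (lam x)) // invMg permM.
  by rewrite permM lamE.
have f_sq x : f x = (lam x)^-1%g ((lam x)^-1%g x).
  by rewrite /f; congr (_ _); apply/esym/(canLR (permK _)); rewrite lamE.
have f_inv : involutive f.
  by move=> x; rewrite [f x]f_sq !f_act ?groupV // invgK /f permKV lamE.
have f_inj := inv_inj f_inv.
exists (perm f_inj); split=> [|l x Ll|x].
- have rep0 : rep x0 = x0 by rewrite /rep orbit_refl.
  by rewrite permE (fE 1%g) // ?invg1 ?perm1 rep0 // perm1.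
- by rewrite !(permE f_inj) f_act.
by exists (lam x)^-1%g; rewrite ?groupV // permE.
Qed.

(** Colour by the parity of the distance from the root of the cycle; even length makes the closing
    step consistent. *)
Lemma injective_bipartition (T : finType) (f : T -> T) :
    injective f -> (forall x, ~~ odd (fingraph.order f x)) ->
  exists eps : T -> bool, forall x, eps (f x) = ~~ eps x.
Proof.
move=> injf evenf; exists (fun x => odd (findex f (froot f x) x)) => x.
have -> : froot f (f x) = froot f x.
  apply/esym/eqP; rewrite root_connect ?fconnect1 //; exact: fconnect_sym.
set y := froot f x; have yx : fconnect f y x.
  by rewrite fconnect_sym // connect_root.
have lt_m := findex_max yx; move: (iter_findex yx).
move: (findex f y x) lt_m => m lt_m yxE; rewrite -yxE -iterS.
move: lt_m; rewrite leq_eqVlt => /orP[/eqP mE | lt_m]; last by rewrite findex_iter.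
by rewrite mE iter_order // findex0; have := evenf y; rewrite -mE /= => /negPn ->.
Qed.

(** Both [s] and [t \o s] carry one colour class onto the other, so summing the last hypothesis over
    that class meets every index once on each side. *)
Lemma addb_bipartition (I : finType) (c d eps : I -> bool) (s t : I -> I) :
    injective s -> injective t ->
    (forall i, eps (s i) = ~~ eps i) -> (forall i, eps (t i) = eps i) ->
    (forall i, d i (+) d (s i) = c i (+) c (t (s i))) ->
  \big[addb/false]_i d i = \big[addb/false]_i c i.
Proof.
move=> injs injt epss epst dc.
rewrite (bigID eps) [RHS](bigID eps) /=.
rewrite [X in _ (+) X = _](reindex_inj injs) /=.
rewrite [X in _ = _ (+) X](reindex_inj (inj_comp injt injs)) /=.
have E1 i : ~~ eps (s i) = eps i by rewrite epss negbK.
have E2 i : ~~ eps (t (s i)) = eps i by rewrite epst E1.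
rewrite (eq_bigl _ _ E1) [X in _ = _ (+) X](eq_bigl _ _ E2).
by rewrite -!big_split; apply: eq_bigr => i _; apply: dc.
Qed.

(** * Monomial permutations, their weights and colours *)

Definition equivariant {r n} (p : {perm 'I_r.+1 * 'I_n}) :=
  [forall b, forall x, p (x.1 + b, x.2) == ((p x).1 + b, (p x).2)].

(** As a monomial matrix, [p] sends basis vector [i] to the vector [base p i] times a root of unity
    with exponent [weight p i]; [color p] is the exponent of the product of the nonzero entries. *)
Definition weight {r n} (p : {perm 'I_r.+1 * 'I_n}) (i : 'I_n) := (p (0, i)).1.
Definition base {r n} (p : {perm 'I_r.+1 * 'I_n}) (i : 'I_n) := (p (0, i)).2.
Definition color {r n} (p : {perm 'I_r.+1 * 'I_n}) := \sum_i weight p i.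

Lemma equivariantP r n (p : {perm 'I_r.+1 * 'I_n}) :
  reflect (forall a i, p (a, i) = (a + weight p i, base p i)) (equivariant p).
Proof.
apply: (iffP forallP) => [eqp a i | pE b].
  by have /forallP/(_ (0, i))/eqP := eqp a; rewrite /= add0r addrC.
by apply/forallP=> -[a i]; rewrite !pE /= addrAC.
Qed.

Lemma equivariantM r n (p g : {perm 'I_r.+1 * 'I_n}) :
  equivariant p -> equivariant g -> equivariant (p * g)%g.
Proof.
move=> /equivariantP pE /equivariantP gE; apply/equivariantP=> a i.
by rewrite /weight /base !permM !pE !gE /= add0r addrA.
Qed.

Lemma weightM r n (p g : {perm 'I_r.+1 * 'I_n}) i :
  equivariant g -> weight (p * g)%g i = weight p i + weight g (base p i).
Proof.
by move=> /equivariantP gE; rewrite /weight permM [p _]surjective_pairing gE.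
Qed.

Lemma baseM r n (p g : {perm 'I_r.+1 * 'I_n}) i :
  equivariant g -> base (p * g)%g i = base g (base p i).
Proof.
by move=> /equivariantP gE; rewrite /base permM [p _]surjective_pairing gE.
Qed.

Lemma base1 r n (i : 'I_n) : base (1%g : {perm 'I_r.+1 * 'I_n}) i = i.
Proof. by rewrite /base perm1. Qed.

Lemma equivariantV r n (p : {perm 'I_r.+1 * 'I_n}) :
  equivariant p -> equivariant p^-1%g.
Proof.
move=> /forallP eqp; apply/forallP=> b; apply/forallP=> x; apply/eqP.
apply: (@perm_inj _ p); rewrite permKV.
have /forallP/(_ (p^-1%g x))/eqP := eqp b; rewrite permKV => ->; by case: x.
Qed.

Lemma base_inj r n (p : {perm 'I_r.+1 * 'I_n}) : equivariant p -> injective (base p).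
Proof.
move=> eqp; apply: (can_inj (g := base p^-1%g)) => i.
by rewrite -baseM ?equivariantV // mulgV base1.
Qed.

Lemma colorM r n (p g : {perm 'I_r.+1 * 'I_n}) : equivariant p -> equivariant g ->
  color (p * g)%g = color p + color g.
Proof.
move=> eqp eqg; rewrite /color [X in _ + X](reindex_inj (base_inj eqp)) -big_split.
by apply: eq_bigr => i _; rewrite weightM.
Qed.

Lemma weightV r n (p : {perm 'I_r.+1 * 'I_n}) i :
  equivariant p -> weight p^-1%g (base p i) = - weight p i.
Proof.
move=> eqp; apply/eqP; rewrite -addr_eq0 addrC -weightM ?equivariantV //.
by rewrite mulgV /weight perm1.
Qed.

Lemma colorV r n (p : {perm 'I_r.+1 * 'I_n}) :
  equivariant p -> color p^-1%g = - color p.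
Proof.
move=> eqp; apply/eqP; rewrite -addr_eq0 -colorM ?equivariantV // mulVg.
by rewrite /color big1 // => i _; rewrite /weight perm1.
Qed.

Lemma baseX r n (p : {perm 'I_r.+1 * 'I_n}) m x :
  equivariant p -> ((p ^+ m)%g x).2 = iter m (base p) x.2.
Proof.
move=> /equivariantP pE; elim: m x => [|m IHm] x; first by rewrite expg0 perm1.
by rewrite expgSr permM iterS -IHm [(p ^+ m)%g x]surjective_pairing pE.
Qed.

(** * Diagonal elements and scalars *)

Definition diag_fun {r n} (f : 'I_n -> 'I_r.+1) (x : 'I_r.+1 * 'I_n) :=
  (x.1 + f x.2, x.2).

Lemma diag_inj r n (f : 'I_n -> 'I_r.+1) : injective (diag_fun f).
Proof.
by apply: (can_inj (g := diag_fun (fun i => - f i))) => -[a i];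
   rewrite /diag_fun /= addrK.
Qed.

Definition diag {r n} (f : 'I_n -> 'I_r.+1) := perm (@diag_inj r n f).

Lemma diag_equivariant r n (f : 'I_n -> 'I_r.+1) : equivariant (diag f).
Proof.
by apply/equivariantP=> a i; rewrite /weight /base !permE /diag_fun /= add0r.
Qed.

Lemma weight_diag r n (f : 'I_n -> 'I_r.+1) i : weight (diag f) i = f i.
Proof. by rewrite /weight permE /= add0r. Qed.

Lemma base_diag r n (f : 'I_n -> 'I_r.+1) i : base (diag f) i = i.
Proof. by rewrite /base permE. Qed.

Lemma diag_commute r n (f : 'I_n -> 'I_r.+1) (p : {perm 'I_r.+1 * 'I_n}) :
  equivariant p -> (forall i, f (base p i) = f i) -> commute (diag f) p.
Proof.
move=> /equivariantP pE fp; apply/permP=> -[a i].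
by rewrite !permM pE !permE /diag_fun /= pE fp addrAC.
Qed.

Definition rot {r n} : {perm 'I_r.+1 * 'I_n} := diag (fun=> inZp 1).

Lemma rotX r n m (x : 'I_r.+1 * 'I_n) : (rot ^+ m)%g x = (x.1 + inZp m, x.2).
Proof.
elim: m => [|m IHm].
  rewrite expg0 perm1 [x in LHS]surjective_pairing; congr (_, _).
  by rewrite -[LHS]addr0; congr (_ + _); apply: val_inj; rewrite /= mod0n.
rewrite expgSr permM IHm permE /diag_fun /= -addrA; congr (_ + _, _).
by apply: val_inj; rewrite /= modnDm addn1.
Qed.

(** * Transposition and conjugacy to the transpose *)

Lemma flip_inj r n :
  injective (fun x : 'I_r.+1 * 'I_n => (- x.1, x.2)).
Proof. by apply: can_inj (fun x => (- x.1, x.2)) _ => -[a i] /=; rewrite opprK. Qed.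

Definition flip {r n} : {perm 'I_r.+1 * 'I_n} := perm (@flip_inj r n).

Lemma flipE r n (x : 'I_r.+1 * 'I_n) : flip x = (- x.1, x.2).
Proof. by rewrite permE. Qed.

Lemma flipV r n : (@flip r n)^-1%g = flip.
Proof.
apply: (mulgI flip); rewrite mulgV; apply/permP=> -[a i].
by rewrite perm1 permM !flipE /= opprK.
Qed.

(* On monomial matrices this is transposition: inversion followed by complex
   conjugation of the entries. *)
Definition transp {r n} (p : {perm 'I_r.+1 * 'I_n}) : {perm 'I_r.+1 * 'I_n} :=
  (p^-1 ^ flip)%g.

Lemma transp_anti r n : antimorphic (@transp r n).
Proof. by move=> p g; rewrite /transp invMg conjMg. Qed.

Lemma transpK r n : involutive (@transp r n).
Proof.
move=> p; rewrite /transp -conjVg invgK -conjgM.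
by rewrite -[X in (X * _)%g]flipV mulVg conjg1.
Qed.

Lemma transpE r n (p : {perm 'I_r.+1 * 'I_n}) x :
  transp p x = flip (p^-1%g (flip x)).
Proof. by rewrite /transp conjgE flipV !permM. Qed.

Lemma transp_equivariant r n (p : {perm 'I_r.+1 * 'I_n}) :
  equivariant p -> equivariant (transp p).
Proof.
move=> /equivariantV/equivariantP pE; apply/equivariantP=> a i.
rewrite /weight /base !transpE !flipE /= !pE /=.
by rewrite oppr0 add0r opprD opprK.
Qed.

Lemma base_transp r n (p : {perm 'I_r.+1 * 'I_n}) i :
  base (transp p) i = base p^-1%g i.
Proof. by rewrite /base transpE !flipE /= oppr0. Qed.

Lemma color_transp r n (p : {perm 'I_r.+1 * 'I_n}) :
  equivariant p -> color (transp p) = color p.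
Proof.
move=> eqp; rewrite -[RHS]opprK -colorV // /color -sumrN.
by apply: eq_bigr => i _; rewrite /weight transpE !flipE /= oppr0.
Qed.

(** Take [u] inverting the group generated by [g] and [rot]. It reverses rotations, so [u * flip] is
    equivariant, and it carries [g] to [g^-1 ^ flip]. Since [u] moves each point by a square of that
    group, indices move an even number of steps along cycles of [g]. *)
Lemma transp_conj_equivariant r n (g : {perm 'I_r.+1 * 'I_n}) (a : 'I_n) :
    equivariant g ->
  exists k : {perm 'I_r.+1 * 'I_n},
    [/\ equivariant k, base k a = a,
        forall i, exists m, base k i = iter m (base g) (iter m (base g) i)
      & (g ^ k)%g = transp g].
Proof.
move=> eqg; have cgr : commute rot g by apply: diag_commute.
have eqr : equivariant (@rot r n) by apply: diag_equivariant.
have crg : (<[rot]> \subset 'C(<[g]>))%g by rewrite cents_cycle.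
pose L := (<[g]> <*> <[rot]>)%G.
have LE : L = (<[g]> * <[rot]>)%g :> {set _} by apply: cent_joinEr.
have abL : abelian L by rewrite LE abelianM !cycle_abelian.
have [u [u0 uV u_sq]] := abelian_inverter (0, a) abL.
have uV' l : l \in L -> (l * u = u * l^-1)%g.
  by move=> Ll; apply/permP=> x; rewrite !permM uV.
have Lg : g \in L by rewrite -cycle_subG joing_subl.
have Lr m : (rot ^+ m)%g \in L by rewrite groupX // -cycle_subG joing_subr.
have u_add b x : u (x.1 + b, x.2) = ((u x).1 - b, (u x).2).
  have rotb y : (rot ^+ b)%g y = (y.1 + b, y.2) by rewrite rotX valZpK.
  rewrite -rotb uV //; apply: (@perm_inj _ (rot ^+ b)%g); rewrite permKV rotb /=.
  by rewrite subrK -surjective_pairing.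
exists (u * flip)%g; split.
- apply/forallP=> b; apply/forallP=> x; rewrite !permM !flipE u_add /=.
  by rewrite opprB addrC.
- by rewrite /base permM u0 flipE.
- move=> i; have [l] := u_sq (0, i).
  rewrite LE => /mulsgP[_ _ /cycleP[m ->] /cycleP[j ->] ->].
  move=> uE; exists m; rewrite /base permM flipE /= uE !permM.
  by rewrite rotX /= baseX // rotX /= baseX.
rewrite conjgM; congr (_ ^ _)%g; rewrite conjgE uV' // mulKg //.
Qed.

Lemma dvdn_ZpD r q (x y : 'I_r.+1) :
  (q %| r.+1)%N -> (q %| (x + y)%R)%N = (q %| x + y)%N.
Proof. by move=> qr; rewrite /dvdn /= modn_dvdm. Qed.

Lemma odd_ZpD r (x y : 'I_r.+1) :
  ~~ odd r.+1 -> odd (x + y)%R = odd x (+) odd y.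
Proof. by move=> er; rewrite /= odd_mod ?oddD //; apply: negbTE. Qed.

Lemma Zp_sum_modn (I : finType) r q (z : I -> 'I_r.+1) :
  (q %| r.+1)%N ->
  ((\sum_i z i)%R = \sum_i (z i : nat) %[mod q])%N.
Proof.
move=> qr; apply: (big_ind2 (fun (x : 'I_r.+1) (y : nat) => x = y %[mod q])) => //.
move=> x1 x2 y1 y2 e1 e2 /=; rewrite modn_dvdm //.
by rewrite -modnDm e1 e2 modnDm.
Qed.

Lemma odd_Zp_sum (I : finType) r (z : I -> 'I_r.+1) :
  ~~ odd r.+1 -> odd (\sum_i z i)%R = \big[addb/false]_i odd (z i).
Proof.
by move=> er; apply: (big_morph (fun x : 'I_r.+1 => odd x)) => // x y; apply: odd_ZpD.
Qed.

Lemma weight_transp r n (p : {perm 'I_r.+1 * 'I_n}) i :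
  equivariant p -> weight (transp p) (base p i) = weight p i.
Proof.
move=> eqp; rewrite -[RHS]opprK -weightV //.
by rewrite /weight transpE !flipE /= oppr0.
Qed.

(** If [color k] is odd and [g] has an odd cycle, a diagonal element supported there commutes with
    [g] and corrects the parity. If all cycles are even, [color k] has the parity of [color g]. *)
Lemma transp_conj_even r n (g : {perm 'I_r.+1 * 'I_n}) (a : 'I_n) :
    ~~ odd r.+1 -> equivariant g -> ~~ odd (color g) ->
  exists k : {perm 'I_r.+1 * 'I_n},
    [/\ equivariant k, base k a = a,
        forall i, base g i = i -> base k i = i,
        (g ^ k)%g = transp g & ~~ odd (color k)].
Proof.
move=> even_r eqg even_g.
have [k [eqk ka kg gk]] := transp_conj_equivariant a eqg.
have injg := base_inj eqg.
have k_fix i : base g i = i -> base k i = i.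
  by move=> gi; have [m ->] := kg i; rewrite !(iter_fix _ gi).
have [even_k|odd_k] := boolP (~~ odd (color k)); first by exists k.
have [/existsP[i odd_i] | all_even] :=
    boolP [exists i, odd (fingraph.order (base g) i)].
  pose f j : 'I_r.+1 := inZp (fconnect (base g) i j).
  have fg j : f (base g j) = f j by rewrite /f -same_fconnect1_r.
  have col_f : odd (color (diag f)).
    rewrite odd_Zp_sum //.
    under eq_bigr => j _.
      rewrite weight_diag /f /= odd_mod ?(negPf even_r) // oddb; over.
    move: odd_i; rewrite /fingraph.order -sum1_card.
    rewrite (big_morph odd oddD (erefl : odd 0 = false)) big_mkcond /=.
    rewrite (eq_bigr (fun j => fconnect (base g) i j)) // => j _.
    by rewrite unfold_in; case: ifP.
  exists (diag f * k)%g; split.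
  - by rewrite equivariantM // diag_equivariant.
  - by rewrite baseM // base_diag.
  - by move=> j gj; rewrite baseM // base_diag k_fix.
  - rewrite conjgM -[RHS]gk; congr (_ ^ _)%g.
    by apply/conjg_fixP/commgP/commute_sym/diag_commute.
  rewrite colorM ?diag_equivariant // odd_ZpD // col_f.
  by rewrite negbK in odd_k; rewrite odd_k.
(* All cycles of [g] have even length, so the indices are 2-coloured with [g]
   exchanging the colours and [k] preserving them. *)
have [eps epsg] : exists eps, forall i, eps (base g i) = ~~ eps i.
  apply: injective_bipartition => // i; apply: contra all_even => odd_i.
  by apply/existsP; exists i.
have epsgX m i : eps (iter m (base g) i) = odd m (+) eps i.
  by elim: m => //= m IHm; rewrite epsg IHm addNb.
have epsk i : eps (base k i) = eps i.
  by have [m ->] := kg i; rewrite !epsgX; case: (odd m) => //=; rewrite negbK.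
(* Comparing weights at [i] in [g * k = k * transp g] gives, modulo 2, the relation summed by
   [addb_bipartition]. *)
have rel i :
    weight k i + weight g (base k (base g i)) = weight g i + weight k (base g i).
  have gkE : (g * k = k * transp g)%g by rewrite -gk conjgC.
  have bE : base g (base k (base g i)) = base k i.
    rewrite -[base k _]baseM // gkE baseM ?transp_equivariant // base_transp.
    by rewrite -baseM // mulVg base1.
  rewrite -weightM // gkE weightM ?transp_equivariant //.
  by rewrite -[in RHS]bE weight_transp.
exists k; split=> //; rewrite (_ : odd (color k) = odd (color g)) //.
rewrite !odd_Zp_sum //.
apply: (addb_bipartition (eps := eps)) injg (base_inj eqk) epsg epsk _ => i.
have := congr1 (fun x : 'I_r.+1 => odd x) (rel i); rewrite !odd_ZpD //.
by do 4!case: odd.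
Qed.

(** Scalars commute with [g] and shift colours by multiples of [n], so it suffices that [gcdn q n]
    divides [color k]: automatic for 1, the even case for 2. *)
Lemma transp_conj r q n (g : {perm 'I_r.+1 * 'I_n}) (a : 'I_n) :
    (q %| r.+1)%N -> (gcdn q n <= 2)%N -> equivariant g -> (q %| color g)%N ->
  exists k : {perm 'I_r.+1 * 'I_n},
    [/\ equivariant k, (q %| color k)%N, base k a = a,
        forall i, base g i = i -> base k i = i & (g ^ k)%g = transp g].
Proof.
move=> qr gcd2 eqg qg; have q_gt0 : (0 < q)%N by apply: dvdn_gt0 qr.
have [k [eqk ka k_fix gk gcd_k]] : exists k : {perm 'I_r.+1 * 'I_n},
    [/\ equivariant k, base k a = a, forall i, base g i = i -> base k i = i,
        (g ^ k)%g = transp g & (gcdn q n %| color k)%N].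
  have gcd_gt0 : (0 < gcdn q n)%N by rewrite gcdn_gt0 q_gt0.
  have [gcd_eq2 | gcd_ne2] := eqVneq (gcdn q n) 2%N; last first.
    have -> : gcdn q n = 1%N.
      by case: (gcdn q n) gcd_gt0 gcd2 gcd_ne2 => [|[|[|m]]].
    have [k [eqk ka kg gk]] := transp_conj_equivariant a eqg.
    exists k; split=> // i gi; by have [m ->] := kg i; rewrite !(iter_fix _ gi).
  have q2 : (2 %| q)%N by rewrite -gcd_eq2 dvdn_gcdl.
  have [||k [eqk ka k_fix gk even_k]] := transp_conj_even a _ eqg.
  - by rewrite -dvdn2 (dvdn_trans q2).
  - by rewrite -dvdn2 (dvdn_trans q2).
  by exists k; split=> //; rewrite gcd_eq2 dvdn2.
have /dvdnP[w kE] := gcd_k.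
(* [q] divides [gcdn q n + b * n], so the scalar of exponent [w * b] cancels
   [color k = w * gcdn q n] modulo [q]. *)
have [b _ qb] := Bezoutl n q_gt0.
pose f (i : 'I_n) : 'I_r.+1 := inZp (w * b).
exists (diag f * k)%g; split.
- by rewrite equivariantM // diag_equivariant.
- rewrite colorM ?diag_equivariant // dvdn_ZpD // /dvdn -modnDml Zp_sum_modn //.
  under eq_bigr do rewrite weight_diag /=.
  rewrite sum_nat_const card_ord -modnMmr modn_dvdm // modnMmr modnDml kE.
  rewrite mulnCA -mulnDr -/(dvdn q _) addnC dvdn_mull //.
  by rewrite [(n * b)%N]mulnC.
- by rewrite baseM // base_diag.
- by move=> j gj; rewrite baseM // base_diag k_fix.
rewrite conjgM -[RHS]gk; congr (_ ^ _)%g.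
by apply/conjg_fixP/commgP/commute_sym/diag_commute.
Qed.

(** * The group and its chain of subgroups fixing indices *)

Lemma Grqn_setE r q n (p : {perm 'I_r.+1 * 'I_n}) :
    (q %| r.+1)%N ->
  (p \in Grqn_set r.+1 q n) = equivariant p && (q %| color p)%N.
Proof.
move=> qr; rewrite inE; apply/idP/andP.
  case/existsP=> z /existsP[s /andP[sum0 /forallP pE]].
  have {}pE a i : p (a, i) = (a + z (s i), s i).
    have /andP[/eqP p1 /eqP p2] := pE (a, i).
    by rewrite [p _]surjective_pairing p2; congr (_, _); apply: val_inj.
  split; first by apply/equivariantP=> a i; rewrite /weight /base !pE add0r.
  rewrite /dvdn Zp_sum_modn //; move: sum0.
  rewrite (reindex_inj (@perm_inj _ s)) /=.
  by rewrite (eq_bigr (fun i => weight p i : nat)) // => i _; rewrite /weight pE add0r.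
case=> eqp qp; have injp := base_inj eqp.
pose s := perm injp.
(* [z] is indexed by the image index, hence the [s^-1]. *)
apply/existsP; exists [ffun i => weight p (s^-1%g i)].
apply/existsP; exists s; apply/andP; split.
  rewrite (reindex_inj (@perm_inj _ s)) /=.
  under eq_bigr do rewrite ffunE permK.
  by rewrite -Zp_sum_modn.
apply/forallP=> -[a i]; have /equivariantP -> := eqp.
by rewrite ffunE permK /= permE !eqxx.
Qed.

(* [m = 0] gives the whole group and [m = n] its diagonal subgroup. *)
Definition Grqn_fix_set (r q n m : nat) : {set {perm 'I_r.+1 * 'I_n}} :=
  [set p | [&& equivariant p, (q %| color p)%N
             & [forall i : 'I_n, (i < m)%N ==> (base p i == i)]]].

Lemma Grqn_fixP r q n m (p : {perm 'I_r.+1 * 'I_n}) :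
  reflect [/\ equivariant p, (q %| color p)%N
            & forall i : 'I_n, (i < m)%N -> base p i = i]
          (p \in Grqn_fix_set r q n m).
Proof.
rewrite inE; apply: (iffP and3P) => -[eqp qp fp]; split=> //.
  by move=> i im; apply/eqP; apply: (implyP (forallP fp i)).
by apply/forallP=> i; apply/implyP=> im; apply/eqP/fp.
Qed.

Lemma Grqn_fix_group_set r q n m :
  (q %| r.+1)%N -> group_set (Grqn_fix_set r q n m).
Proof.
move=> qr; apply/group_setP; split.
  apply/Grqn_fixP; split=> [||i _].
  - by apply/equivariantP=> a i; rewrite /weight /base !perm1 addr0.
  - by rewrite /color big1 // => i _; rewrite /weight perm1.
  exact: base1.
move=> p g /Grqn_fixP[eqp qp fp] /Grqn_fixP[eqg qg fg]; apply/Grqn_fixP.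
split=> [||i im]; first exact: equivariantM.
  by rewrite colorM // dvdn_ZpD // dvdn_add.
by rewrite baseM // fp // fg.
Qed.

Definition Grqn_fix (r q n m : nat) (qr : (q %| r.+1)%N) :
  {group {perm 'I_r.+1 * 'I_n}} := Group (@Grqn_fix_group_set r q n m qr).

Lemma Grqn_fix0 r q n (qr : (q %| r.+1)%N) :
  Grqn r.+1 q n = Grqn_fix n 0 qr.
Proof.
have E : Grqn_set r.+1 q n = Grqn_fix_set r q n 0.
  apply/setP=> p; rewrite Grqn_setE // [in RHS]inE.
  have -> : [forall i : 'I_n, (i < 0)%N ==> (base p i == i)] by apply/forallP.
  by rewrite andbT.
by apply: val_inj; rewrite /= E gen_set_id ?Grqn_fix_group_set.
Qed.

Lemma transp_Grqn_fix r q n m (qr : (q %| r.+1)%N) :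
  {in Grqn_fix n m qr, forall p, transp p \in Grqn_fix n m qr}.
Proof.
move=> p /Grqn_fixP[eqp qp fp]; apply/Grqn_fixP.
split=> [||i im]; first exact: transp_equivariant.
  by rewrite color_transp.
by rewrite base_transp -{1}(fp i im) -baseM ?equivariantV // mulgV base1.
Qed.

Lemma Grqn_fix_abelian r q n (qr : (q %| r.+1)%N) : abelian (Grqn_fix n n qr).
Proof.
apply/centsP=> p /Grqn_fixP[/equivariantP pE _ fp] g /Grqn_fixP[/equivariantP gE _ fg].
by apply/permP=> -[a i]; rewrite !permM !(pE, gE) !fp ?fg // addrAC.
Qed.

(** The conjugator keeps the indices fixed by [g] and can be made to fix one more, [a]; this is what
    each descent step needs. *)
Lemma Grqn_fix_transp_conj r q n m (qr : (q %| r.+1)%N) (a : 'I_n) :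
    (gcdn q n <= 2)%N -> a = m :> nat ->
  {in Grqn_fix n m qr, forall g,
    exists2 k, k \in Grqn_fix n m.+1 qr & transp g = (g ^ k)%g}.
Proof.
move=> gcd2 am g /Grqn_fixP[eqg qg fg].
have [k [eqk qk ka k_fix gk]] := transp_conj a qr gcd2 eqg qg.
exists k => //; apply/Grqn_fixP; split=> // i; rewrite ltnS leq_eqVlt.
case/orP=> [/eqP im | im]; last by rewrite k_fix ?fg.
by have -> : i = a by apply/ord_inj; rewrite im am.
Qed.

Lemma Grqn_fix_sub r q n m (qr : (q %| r.+1)%N) :
  Grqn_fix n m.+1 qr \subset Grqn_fix n m qr.
Proof.
apply/subsetP=> p /Grqn_fixP[eqp qp fp]; apply/Grqn_fixP; split=> // i im.
by rewrite fp // ltnW.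
Qed.

(** Induction up the chain from the abelian diagonal subgroup, with [m] counting the indices left
    free. *)
Lemma Grqn_fix_symmetric_intertwiners r q n m (qr : (q %| r.+1)%N) :
    (gcdn q n <= 2)%N -> (m <= n)%N ->
  symmetric_intertwiners transp (Grqn_fix n (n - m) qr).
Proof.
move=> gcd2; elim: m => [_|m IHm lt_mn].
  by rewrite subn0; apply/abelian_symmetric_intertwiners/Grqn_fix_abelian.
have lt_n : (n - m.+1 < n)%N by rewrite ltn_subrL (leq_ltn_trans _ lt_mn).
have nmE : (n - m = (n - m.+1).+1)%N by rewrite subnSK.
apply: (subgroup_symmetric_intertwiners (H := Grqn_fix n (n - m.+1).+1 qr)).
- exact: transp_anti.
- exact: transpK.
- exact: Grqn_fix_sub.
- exact: transp_Grqn_fix.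
- exact: transp_Grqn_fix.
- exact: (@Grqn_fix_transp_conj _ _ _ _ qr (Ordinal lt_n) gcd2 erefl).
by rewrite -nmE; apply/IHm/ltnW.
Qed.

Unset Implicit Arguments.

Theorem theorem6p9 (r q n : nat) (hr : (0 < r)%N) (hq : (0 < q)%N) (hn : (0 < n)%N)
    (hqr : (q %| r)%N) (hgcd : (gcdn q n <= 2)%N) :
  Gamma_e (Grqn r q n) <= char_table_sum (Grqn r q n) /\
  (char_table_sum (Grqn r q n) = Gamma_e (Grqn r q n) <-> abelian (Grqn r q n)).
Proof.
case: r hr hqr => // r _ qr; rewrite (Grqn_fix0 n qr).
apply: (char_table_sum_twisted (sigma := transp)).
- exact: transp_anti.
- exact: transp_Grqn_fix.
- move=> g Gg.
  have [k Gk ->] := @Grqn_fix_transp_conj r q n 0 qr (Ordinal hn) hgcd erefl g Gg.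
  by exists k => //; apply: (subsetP (Grqn_fix_sub n 0 qr)).
by rewrite -(subnn n); apply: Grqn_fix_symmetric_intertwiners.
Qed.
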